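(* Free left $h$-Ehresmann monoids are finitely left equated, finitely right equated, weakly left coherent and weakly right coherent; i.e. for every set $X$, the free left $h$-Ehresmann monoid on $X$ has all four of these properties.
   Context: A semigroup $S$ with a unary operation ${}^+$ is left Ehresmann if $x^+x=x$, $(x^+y^+)^+=x^+y^+=y^+x^+$ and $(xy)^+=(xy^+)^+$ for all $x,y\in S$; it is left $h$-Ehresmann if moreover $(xz^+y)^+=(xy)^+(xz)^+$ for all $x,y,z\in S$. A left $h$-Ehresmann monoid is such a structure with a multiplicative identity, regarded as a $(2,1,0)$-algebra (product, ${}^+$, identity). The free left $h$-Ehresmann monoid on a set $X$ is the (unique up to isomorphism) left $h$-Ehresmann monoid $F$ containing $X$ such that for every left $h$-Ehresmann monoid $M$ every function $X\to M$ extends to a unique $(2,1,0)$-morphism $F\to M$. Let $M$ be a monoid. $M$ is weakly right coherent if every finitely generated right ideal of $M$ is finitely presented as a right $M$-act (a right $M$-act is finitely presented if it is isomorphic to a quotient of a finitely generated free right $M$-act by a finitely generated right act congruence). For $a\in M$, the right annihilator congruence $\mathbf{r}(a)$ is the right congruence on $M$ given by $u\mathrel{\mathbf{r}(a)}v$ if and only if $au=av$; $M$ is finitely right equated if $\mathbf{r}(a)$ is finitely generated as a right congruence for all $a\in M$. Weakly left coherent and finitely left equated are the left-right dual notions (using left ideals, left $M$-acts, and the left congruences $\{(u,v): ua=va\}$). *)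

(* Defs.v *)
From HB Require Import structures.
From mathcomp Require Import all_boot.
From mathcomp Require Import boolp classical_sets.

Set Implicit Arguments.
Unset Strict Implicit.
Unset Printing Implicit Defensive.

Local Open Scope quotient_scope.
Local Open Scope classical_set_scope.
Local Open Scope group_scope.

HB.mixin Record isLeftEhresmann S of Semigroup S := {
  plus : S -> S;
  plus_mull : forall x : S, plus x * x = x;
  plus_mul_plus : forall x y : S, plus (plus x * plus y) = plus x * plus y;
  plus_comm : forall x y : S, plus x * plus y = plus y * plus x;
  plus_mulr : forall x y : S, plus (x * y) = plus (x * plus y)
}.

#[short(type="leftEhresmannSemigroupType")]
HB.structure Definition LeftEhresmannSemigroup :=
  {S of isLeftEhresmann S & Semigroup S}.

HB.mixin Record isLeftHEhresmann S of LeftEhresmannSemigroup S := {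
  plus_h : forall x y z : S, plus (x * plus z * y) = plus (x * y) * plus (x * z)
}.

#[short(type="leftHEhresmannSemigroupType")]
HB.structure Definition LeftHEhresmannSemigroup :=
  {S of isLeftHEhresmann S & LeftEhresmannSemigroup S}.

#[short(type="leftHEhresmannMonoidType")]
HB.structure Definition LeftHEhresmannMonoid :=
  {S of LeftHEhresmannSemigroup S & Monoid S}.

Definition lhe_morphism (F M : leftHEhresmannMonoidType) (f : F -> M) : Prop :=
  [/\ {morph f : x y / x * y}, {morph f : x / plus x} & f 1 = 1].

(* The carriers of MathComp monoids are choiceTypes. This is no restriction on
   M: classically every type is one, by boolp.gen_choiceMixin. *)
Definition is_free_lhe (X : Type) (F : leftHEhresmannMonoidType)
    (iota : X -> F) : Prop :=
  injective iota /\
  forall (M : leftHEhresmannMonoidType) (g : X -> M),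
    exists f : F -> M,
      [/\ lhe_morphism f,
          forall x, f (iota x) = g x &
          forall f' : F -> M, lhe_morphism f' ->
            (forall x, f' (iota x) = g x) -> forall y, f' y = f y].

HB.mixin Record isRightAct (M : monoidType) A := {
  ract : A -> M -> A;
  ract1 : forall a : A, ract a 1 = a;
  ractM : forall (a : A) (u v : M), ract a (u * v) = ract (ract a u) v
}.

#[short(type="rightActType")]
HB.structure Definition RightAct (M : monoidType) :=
  {A of isRightAct M A & Choice A}.

Definition ract_isomorphic (M : monoidType) (A B : rightActType M) : Prop :=
  exists f : A -> B,
    bijective f /\ forall (a : A) (m : M), f (ract a m) = ract (f a) m.

(* M acting on itself; an alias, so that M keeps no act instance of its own. *)
Definition regular_act (M : monoidType) : Type := M.

HB.instance Definition _ (M : monoidType) := Choice.on (regular_act M).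
HB.instance Definition _ (M : monoidType) :=
  @isRightAct.Build M (regular_act M) (fun a m => (a : M) * m)
    (@mulg1 M) (@mulgA M).

Definition free_act (Y : choiceType) (M : monoidType) : Type := (Y * M)%type.

Section FreeAct.
Variables (Y : choiceType) (M : monoidType).

Definition free_ract (p : free_act Y M) (m : M) : free_act Y M :=
  (p.1, p.2 * m).

Lemma free_ract1 p : free_ract p 1 = p.
Proof. by case: p => y u; rewrite /free_ract /= mulg1. Qed.

Lemma free_ractM p u v : free_ract p (u * v) = free_ract (free_ract p u) v.
Proof. by rewrite /free_ract /= mulgA. Qed.

HB.instance Definition _ := Choice.on (free_act Y M).
HB.instance Definition _ :=
  @isRightAct.Build M (free_act Y M) free_ract free_ract1 free_ractM.
End FreeAct.

Record ract_congruence (M : monoidType) (A : rightActType M) := RactCongruence {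
  cong_rel :> A -> A -> Prop;
  cong_refl : forall x, cong_rel x x;
  cong_sym : forall x y, cong_rel x y -> cong_rel y x;
  cong_trans : forall x y z, cong_rel x y -> cong_rel y z -> cong_rel x z;
  cong_ract : forall x y (m : M), cong_rel x y -> cong_rel (ract x m) (ract y m)
}.

Definition fg_congruence (M : monoidType) (A : rightActType M)
    (rho : ract_congruence A) : Prop :=
  exists H : seq (A * A),
    (forall p, p \in H -> rho p.1 p.2) /\
    forall sigma : ract_congruence A,
      (forall p, p \in H -> sigma p.1 p.2) ->
      forall x y, rho x y -> sigma x y.

Section QuotientAct.
Variables (M : monoidType) (A : rightActType M) (rho : ract_congruence A).

Definition cong_bool : rel A := fun x y => `[< rho x y >].

Lemma cong_bool_refl : reflexive cong_bool.
Proof. by move=> x; apply/asboolP/cong_refl. Qed.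

Lemma cong_bool_sym : symmetric cong_bool.
Proof. by move=> x y; apply/asboolP/asboolP; apply: cong_sym. Qed.

Lemma cong_bool_trans : transitive cong_bool.
Proof.
by move=> y x z /asboolP xy /asboolP yz; apply/asboolP/(cong_trans xy yz).
Qed.

Canonical cong_equiv :=
  EquivRel cong_bool cong_bool_refl cong_bool_sym cong_bool_trans.

Definition quotient_act : Type := {eq_quot cong_equiv}.

HB.instance Definition _ := Choice.on quotient_act.
HB.instance Definition _ := EqQuotient.on quotient_act.

Definition quotient_ract (c : quotient_act) (m : M) : quotient_act :=
  \pi_quotient_act (ract (repr c) m).

Lemma quotient_ract_pi (a : A) (m : M) :
  quotient_ract (\pi_quotient_act a) m = \pi_quotient_act (ract a m).
Proof.
apply/eqmodP/asboolP/cong_ract/asboolP.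
by apply/(@eqmodP _ cong_equiv); rewrite reprK.
Qed.

Lemma quotient_ract1 c : quotient_ract c 1 = c.
Proof. by rewrite /quotient_ract ract1 reprK. Qed.

Lemma quotient_ractM c u v :
  quotient_ract c (u * v) = quotient_ract (quotient_ract c u) v.
Proof. by rewrite {1}/quotient_ract ractM -quotient_ract_pi. Qed.

HB.instance Definition _ :=
  @isRightAct.Build M quotient_act quotient_ract quotient_ract1 quotient_ractM.
End QuotientAct.

(* The finitely generated free acts are, up to isomorphism, the free acts on
   'I_n. *)
Definition finitely_presented (M : monoidType) (A : rightActType M) : Prop :=
  exists (n : nat) (rho : ract_congruence (free_act 'I_n M)),
    fg_congruence rho /\ ract_isomorphic A (quotient_act rho).

Record right_ideal (M : monoidType) := RightIdeal {
  ideal_set : set M;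
  ideal_mulr : forall x m : M, ideal_set x -> ideal_set (x * m)
}.

Definition fg_right_ideal (M : monoidType) (I : right_ideal M) : Prop :=
  exists s : seq M,
    ideal_set I = [set x | exists2 a, a \in s & exists m, x = a * m].

Definition ideal_act (M : monoidType) (I : right_ideal M) : Type :=
  set_type (ideal_set I).

Section IdealAct.
Variables (M : monoidType) (I : right_ideal M).

Lemma ideal_ract_subproof (x : ideal_act I) (m : M) :
  val x * m \in ideal_set I.
Proof. by apply/mem_set/ideal_mulr/set_mem/valP. Qed.

Definition ideal_ract (x : ideal_act I) (m : M) : ideal_act I :=
  exist _ (val x * m) (ideal_ract_subproof x m).

Lemma ideal_ract1 x : ideal_ract x 1 = x.
Proof. by apply: val_inj; rewrite /= mulg1. Qed.

Lemma ideal_ractM x u v : ideal_ract x (u * v) = ideal_ract (ideal_ract x u) v.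
Proof. by apply: val_inj; rewrite /= mulgA. Qed.

HB.instance Definition _ := Choice.on (ideal_act I).
HB.instance Definition _ :=
  @isRightAct.Build M (ideal_act I) ideal_ract ideal_ract1 ideal_ractM.
End IdealAct.

Definition weakly_right_coherent (M : monoidType) : Prop :=
  forall I : right_ideal M, fg_right_ideal I -> finitely_presented (ideal_act I).

Section RightAnnihilator.
Variables (M : monoidType) (a : M).

Definition rannih_rel (u v : regular_act M) : Prop :=
  a * (u : M) = a * (v : M).

Lemma rannih_ract (u v : regular_act M) (m : M) :
  rannih_rel u v -> rannih_rel (ract u m) (ract v m).
Proof.
by rewrite /rannih_rel => uv; change (a * ((u : M) * m) = a * ((v : M) * m));
   rewrite !mulgA uv.
Qed.

Definition rannih : ract_congruence (regular_act M) :=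
  @RactCongruence M (regular_act M) rannih_rel
    (fun _ => erefl) (fun _ _ uv => esym uv)
    (fun _ _ _ uv vw => etrans uv vw) rannih_ract.
End RightAnnihilator.

Definition finitely_right_equated (M : monoidType) : Prop :=
  forall a : M, fg_congruence (rannih a).

(* Left ideals, left acts and left congruences of M are right ideals, right
   acts and right congruences of the opposite monoid. *)
Definition opposite (M : monoidType) : Type := M.

HB.instance Definition _ (M : monoidType) := Choice.on (opposite M).
HB.instance Definition _ (M : monoidType) :=
  @isMonoid.Build (opposite M) (fun x y => (y : M) * (x : M)) (1 : M)
    (fun x y z => esym (@mulgA M z y x)) (@mulg1 M) (@mul1g M).

Definition weakly_left_coherent (M : monoidType) : Prop :=
  weakly_right_coherent (opposite M).

Definition finitely_left_equated (M : monoidType) : Prop :=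
  finitely_right_equated (opposite M).

Inductive lhe_term (X : Type) : Type :=
| lhe_var of X
| lhe_one
| lhe_mul of lhe_term X & lhe_term X
| lhe_plus of lhe_term X.
Arguments lhe_one {X}.

HB.instance Definition _ (X : Type) := gen_eqMixin (lhe_term X).
HB.instance Definition _ (X : Type) := gen_choiceMixin (lhe_term X).

Fixpoint lhe_eval (X : Type) (M : leftHEhresmannMonoidType) (g : X -> M)
    (t : lhe_term X) : M :=
  match t with
  | lhe_var x => g x
  | lhe_one => 1
  | lhe_mul t1 t2 => lhe_eval g t1 * lhe_eval g t2
  | lhe_plus t1 => plus (lhe_eval g t1)
  end.

Section FreeLhe.
Variable X : Type.

Definition lhe_equiv_bool : rel (lhe_term X) := fun t u =>
  `[< forall (M : leftHEhresmannMonoidType) (g : X -> M),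
        lhe_eval g t = lhe_eval g u >].

Lemma lhe_equiv_refl : reflexive lhe_equiv_bool.
Proof. by move=> t; apply/asboolP. Qed.

Lemma lhe_equiv_sym : symmetric lhe_equiv_bool.
Proof. by move=> t u; apply/asboolP/asboolP => tu M g; rewrite tu. Qed.

Lemma lhe_equiv_trans : transitive lhe_equiv_bool.
Proof.
by move=> u t v /asboolP tu /asboolP uv; apply/asboolP => M g; rewrite tu uv.
Qed.

Canonical lhe_equiv :=
  EquivRel lhe_equiv_bool lhe_equiv_refl lhe_equiv_sym lhe_equiv_trans.

Definition free_lhe : Type := {eq_quot lhe_equiv}.

HB.instance Definition _ := Choice.on free_lhe.
HB.instance Definition _ := EqQuotient.on free_lhe.

Definition free_eval (M : leftHEhresmannMonoidType) (g : X -> M)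
  (c : free_lhe) : M := lhe_eval g (repr c).

Lemma free_eval_pi (M : leftHEhresmannMonoidType) (g : X -> M) t :
  free_eval g (\pi_free_lhe t) = lhe_eval g t.
Proof.
have : repr (\pi_free_lhe t) = t %[mod free_lhe] by rewrite reprK.
by move/(@eqmodP _ lhe_equiv)/asboolP/(_ M g).
Qed.

Lemma free_lhe_ext (c d : free_lhe) :
  (forall (M : leftHEhresmannMonoidType) (g : X -> M),
     free_eval g c = free_eval g d) -> c = d.
Proof.
by move=> cd; rewrite -[c]reprK -[d]reprK; apply/eqmodP/asboolP/cd.
Qed.

Definition free_lhe_mul (c d : free_lhe) : free_lhe :=
  \pi_free_lhe (lhe_mul (repr c) (repr d)).
Definition free_lhe_one : free_lhe := \pi_free_lhe lhe_one.
Definition free_lhe_plus (c : free_lhe) : free_lhe :=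
  \pi_free_lhe (lhe_plus (repr c)).

Lemma free_eval_mul (M : leftHEhresmannMonoidType) (g : X -> M) c d :
  free_eval g (free_lhe_mul c d) = free_eval g c * free_eval g d.
Proof. by rewrite free_eval_pi. Qed.

Lemma free_eval_one (M : leftHEhresmannMonoidType) (g : X -> M) :
  free_eval g free_lhe_one = 1.
Proof. by rewrite free_eval_pi. Qed.

Lemma free_eval_plus (M : leftHEhresmannMonoidType) (g : X -> M) c :
  free_eval g (free_lhe_plus c) = plus (free_eval g c).
Proof. by rewrite free_eval_pi. Qed.

Let evalE := (free_eval_mul, free_eval_one, free_eval_plus).

Lemma free_lhe_mulA : associative free_lhe_mul.
Proof. by move=> *; apply: free_lhe_ext => M g; rewrite !evalE mulgA. Qed.
Lemma free_lhe_mul1 : left_id free_lhe_one free_lhe_mul.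
Proof. by move=> *; apply: free_lhe_ext => M g; rewrite !evalE mul1g. Qed.
Lemma free_lhe_mulr1 : right_id free_lhe_one free_lhe_mul.
Proof. by move=> *; apply: free_lhe_ext => M g; rewrite !evalE mulg1. Qed.

HB.instance Definition _ :=
  @isMonoid.Build free_lhe _ _ free_lhe_mulA free_lhe_mul1 free_lhe_mulr1.

Lemma free_lhe_plus_mull (x : free_lhe) : free_lhe_plus x * x = x.
Proof. by apply: free_lhe_ext => M g; rewrite !evalE plus_mull. Qed.
Lemma free_lhe_plus_mul_plus (x y : free_lhe) :
  free_lhe_plus (free_lhe_plus x * free_lhe_plus y) =
  free_lhe_plus x * free_lhe_plus y.
Proof. by apply: free_lhe_ext => M g; rewrite !evalE plus_mul_plus. Qed.
Lemma free_lhe_plus_comm (x y : free_lhe) :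
  free_lhe_plus x * free_lhe_plus y = free_lhe_plus y * free_lhe_plus x.
Proof. by apply: free_lhe_ext => M g; rewrite !evalE plus_comm. Qed.
Lemma free_lhe_plus_mulr (x y : free_lhe) :
  free_lhe_plus (x * y) = free_lhe_plus (x * free_lhe_plus y).
Proof. by apply: free_lhe_ext => M g; rewrite !evalE plus_mulr. Qed.

HB.instance Definition _ :=
  @isLeftEhresmann.Build free_lhe _ free_lhe_plus_mull free_lhe_plus_mul_plus
    free_lhe_plus_comm free_lhe_plus_mulr.

Lemma free_lhe_plus_h (x y z : free_lhe) :
  plus (x * plus z * y) = plus (x * y) * plus (x * z).
Proof. by apply: free_lhe_ext => M g; rewrite !evalE plus_h. Qed.

HB.instance Definition _ := @isLeftHEhresmann.Build free_lhe free_lhe_plus_h.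

End FreeLhe.

(* Any monoid with constant plus 1 is left h-Ehresmann; this one separates the
   variables. *)
Definition andb_lhe : Type := bool.
HB.instance Definition _ := Choice.on andb_lhe.
HB.instance Definition _ := @isMonoid.Build andb_lhe andb true andbA andTb andbT.
HB.instance Definition _ :=
  @isLeftEhresmann.Build andb_lhe (fun=> true) (fun=> erefl) (fun _ _ => erefl)
    (fun _ _ => erefl) (fun _ _ => erefl).
HB.instance Definition _ :=
  @isLeftHEhresmann.Build andb_lhe (fun _ _ _ => erefl).

Lemma free_lhe_exists (X : Type) :
  exists (F : leftHEhresmannMonoidType) (iota : X -> F), is_free_lhe iota.
Proof.
exists (free_lhe X), (fun x => \pi_(free_lhe X) (lhe_var x)); split=> [x y xy|M g].
  have: free_eval (fun z => `[< z = x >] : andb_lhe) (\pi_(free_lhe X) (lhe_var x))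
      = free_eval (fun z => `[< z = x >] : andb_lhe) (\pi_(free_lhe X) (lhe_var y)).
    by rewrite xy.
  rewrite !free_eval_pi /= => e.
  by apply/esym/asboolP; rewrite -[asbool _]e; apply/asboolP.
exists (free_eval g); split=> [|x|f' [f'M f'P f'1] f'g y].
- split=> [c d|c|]; first exact: free_eval_mul.
    exact: free_eval_plus.
  exact: free_eval_one.
- by rewrite free_eval_pi.
have mulE t u : \pi_(free_lhe X) (lhe_mul t u)
    = \pi_(free_lhe X) t * \pi_(free_lhe X) u.
  by apply: free_lhe_ext => N h; rewrite free_eval_mul !free_eval_pi.
have plusE t : \pi_(free_lhe X) (lhe_plus t) = plus (\pi_(free_lhe X) t).
  by apply: free_lhe_ext => N h; rewrite free_eval_plus !free_eval_pi.
rewrite -[y]reprK free_eval_pi; elim: (repr y) => [x||t IHt u IHu|t IHt] /=.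
- exact: f'g.
- exact: f'1.
- by rewrite mulE f'M IHt IHu.
- by rewrite plusE f'P IHt.
Qed.

(* Main.v *)
(* The free left h-Ehresmann monoid on X has a concrete model: an element is a
   word w = x_1 ... x_n together with a finite prefix-closed set of words A_i
   attached to each position, with x_i A_i contained in A_(i-1).  It stands for
   e(A_0) x_1 e(A_1) ... x_n e(A_n), where e(A) is the product of the u^+ with
   u in A; the h-identity makes these the only idempotents needed.  In the model
   each principal annihilator congruence, on either side, is that of an
   idempotent, hence generated by one pair, and two principal ideals with a
   common element intersect in a principal ideal.  Coherence then follows as
   for monoids with least common multiples. *)
From HB Require Import structures.
Require Import Defs.
From mathcomp Require Import all_boot.
From mathcomp Require Import boolp classical_sets finmap cardinality zify.

Set Implicit Arguments.
Unset Strict Implicit.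
Unset Printing Implicit Defensive.

Local Open Scope quotient_scope.
Local Open Scope classical_set_scope.
Local Open Scope group_scope.

(** * A criterion for weak coherence *)

(** Taking [u = e] and [v = 1] shows that [e] is idempotent, and [e] has the same right annihilator
    congruence as [a]. Thus [aM] is isomorphic to [eM]: this is the condition that principal right
    ideals are projective. *)
Definition right_stabilized (M : monoidType) : Prop :=
  forall a : M, exists e : M,
    a * e = a /\ forall u v : M, a * u = a * v -> e * u = e * v.

Definition right_lcm (M : monoidType) : Prop :=
  forall a b u v : M, a * u = b * v ->
    exists p q : M, a * p = b * q /\
      forall u' v', a * u' = b * v' -> exists m, a * u' = a * p * m.

Section Coherence.
Variable M : monoidType.
Hypothesis stab : right_stabilized M.

(** The single pair [(1, e)] generates: acting by [z] relates [z] to [e * z], so [a * x = a * y]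
    links [x] to [e * x = e * y] and then to [y]. *)
Lemma right_stabilized_equated : finitely_right_equated M.
Proof.
move=> a; have [e [ae eP]] := stab a.
exists [:: (1, e) : regular_act M * regular_act M]; split.
  by move=> p; rewrite inE => /eqP -> /=; rewrite /rannih_rel mulg1 ae.
move=> sigma /(_ (1, e) (mem_head _ _)) /= se x y /eP exy.
have sx z : sigma z (e * z : M).
  by have := cong_ract (z : M) se; rewrite /ract /= mul1g.
by apply: cong_trans (sx x) _; rewrite exy; apply/cong_sym/sx.
Qed.

Hypothesis lcm : right_lcm M.

Section Presentation.
Variable s : seq M.
Let gen (i : 'I_(size s)) : M := nth 1 s i.
Let F := free_act 'I_(size s) M.

(** Kernel of the act morphism from the free act onto the right ideal generated by [s]. *)
Definition relation_rel (p q : F) : Prop := gen p.1 * p.2 = gen q.1 * q.2.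

Lemma relation_ract (p q : F) (m : M) :
  relation_rel p q -> relation_rel (ract p m) (ract q m).
Proof. by rewrite /relation_rel /= !mulgA => ->. Qed.

Definition relation_cong : ract_congruence F :=
  @RactCongruence M F relation_rel (fun _ => erefl) (fun _ _ uv => esym uv)
    (fun _ _ _ uv vw => etrans uv vw) relation_ract.

(** The list holds the one relation given by the least common multiple if the two principal ideals
    meet, and is empty otherwise. Only [u] is factored; the equation for [v] follows from the
    relation. *)
Lemma relation_pair (ij : 'I_(size s) * 'I_(size s)) :
  exists l : seq (F * F),
    (forall p, p \in l -> relation_cong p.1 p.2) /\
    forall u v, relation_rel (ij.1, u) (ij.2, v) -> exists p q m : M,
      ((ij.1, p), (ij.2, q)) \in l /\ gen ij.1 * u = gen ij.1 * p * m.
Proof.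
case: ij => i j /=.
have [[u [v uv]]|no] := pselect (exists u v, gen i * u = gen j * v).
  have [p [q [pq pP]]] := lcm uv.
  exists [:: ((i, p) : F, (j, q) : F)]; split.
    by move=> r; rewrite inE => /eqP ->.
  move=> u' v' /pP [m um]; exists p, q, m; split=> //.
  by rewrite inE.
by exists [::]; split=> // u v uv; case: no; exists u, v.
Qed.

Lemma relation_fg : fg_congruence relation_cong.
Proof.
have [e eP] := choice (fun i => stab (gen i)).
have [l lP] := choice relation_pair.
exists ([seq ((i, 1) : F, (i, e i) : F) | i <- enum 'I_(size s)]
        ++ flatten [seq l ij | ij <- enum {: 'I_(size s) * 'I_(size s)}]); split.
  move=> p; rewrite mem_cat => /orP[/mapP[i _ ->]|/flatten_mapP[ij _]].
    by rewrite /= /relation_rel /= mulg1 (eP i).1.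
  by have [+ _] := lP ij; apply.
move=> sigma sH [i u] [j v] uv.
have se k z : sigma (k, z) (k, e k * z).
  have: sigma (k, 1) (k, e k).
    by apply: (sH (_, _)); rewrite mem_cat; apply/orP; left;
       apply: map_f; rewrite mem_enum.
  by move=> /(cong_ract z); rewrite /ract /= /free_ract /= mul1g.
have [p [q [m [pq um]]]] := (lP (i, j)).2 u v uv.
have /= pq_rel := (lP (i, j)).1 _ pq.
have spq : sigma (i, p) (j, q).
  apply: (sH (_, _)); rewrite mem_cat; apply/orP; right.
  by apply/flatten_mapP; exists (i, j); rewrite ?mem_enum.
(* The chain is [(i, u)], [(i, e i * u) = (i, e i * p * m)], [(i, p * m)], [(j, q * m)],
   [(j, e j * q * m) = (j, e j * v)], [(j, v)]. *)
apply: cong_trans (se i u) _.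
rewrite ((eP i).2 u (p * m)) ?mulgA //.
rewrite -mulgA; apply: cong_trans (cong_sym (se i _)) _.
apply: cong_trans (cong_ract m spq) _; rewrite /ract /= /free_ract /=.
apply: cong_trans (se j _) _; rewrite ((eP j).2 (q * m) v); last first.
  by rewrite mulgA -[gen j * q]pq_rel /= -um; exact: uv.
exact/cong_sym/se.
Qed.

End Presentation.

(** First isomorphism theorem: the ideal is the image of the free act, hence its quotient by the
    kernel [relation_cong s]. The map [r] chooses preimages. *)
Lemma right_stabilized_lcm_coherent : weakly_right_coherent M.
Proof.
move=> I [s sI]; exists (size s), (relation_cong s); split.
  exact: relation_fg.
have repI (x : ideal_act I) : exists p : free_act 'I_(size s) M,
    val x = nth 1 s p.1 * p.2.
  have := set_mem (valP x); rewrite {1}sI => -[a /(nthP 1)[i lti <-] [m xm]].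
  by exists (Ordinal lti, m).
have [r rP] := choice repI.
have inI (p : free_act 'I_(size s) M) : nth 1 s p.1 * p.2 \in ideal_set I.
  by apply/mem_set; rewrite sI; exists (nth 1 s p.1); [exact: mem_nth | exists p.2].
have piE (p q : free_act 'I_(size s) M) : relation_rel p q ->
    \pi_(quotient_act (relation_cong s)) p = \pi_(quotient_act (relation_cong s)) q.
  by move=> pq; apply/eqmodP/asboolP.
have reprE (p : free_act 'I_(size s) M) :
    relation_rel (repr (\pi_(quotient_act (relation_cong s)) p)) p.
  by apply/(@asboolP (relation_cong s _ _))/(@eqmodP _ (cong_equiv (relation_cong s)));
     rewrite reprK.
exists (fun x => \pi_(quotient_act (relation_cong s)) (r x)); split; last first.
  move=> x m; rewrite {2}/ract /= quotient_ract_pi; apply: piE.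
  by rewrite /relation_rel -rP /= mulgA -rP.
exists (fun c : quotient_act (relation_cong s) =>
  exist (fun x => x \in ideal_set I) _ (inI (repr c)) : ideal_act I).
  by move=> x; apply: val_inj; rewrite /= rP; exact: reprE.
move=> c; rewrite -[RHS]reprK; apply: piE.
by rewrite /relation_rel -rP.
Qed.

End Coherence.

(** * The model of words with layers *)

Section Layers.
Variable X : Type.
Implicit Types (w u : seq X) (P Q : nat -> set (seq X)).

(* In the notation of the header, P i is the set x_1 ... x_i A_i of absolute
   words; it is empty beyond the length of w. *)
Record layering w P : Prop := Layering {
  layer_take : forall i u, P i u -> i <= size w /\ take i u = take i w;
  layer_anti : forall i j u, i <= j -> P j u -> P i u;
  layer_word : forall i, i <= size w -> P i w;
  layer_prefix : forall i k u, i <= k -> P i u -> P i (take k u);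
  layer_finite : forall i, finite_set (P i)
}.

(* For i <= size w the truncated subtraction gives Q 0, so that the idempotent
   part of the right factor is propagated to every position of w. *)
Definition mul_layers w P Q i : set (seq X) :=
  P i `|` cat w @` Q (i - size w)%N.

Definition one_layers i : set (seq X) := [set u | i = 0%N /\ u = [::]].

(** Head and tail of a cut at [k] both keep the set at position [k]: they stand for e(A_0) x_1 ...
    x_k e(A_k) and e(A_k) x_(k+1) ... x_n e(A_n). *)
Definition head_layers k P i : set (seq X) := [set u | i <= k /\ P i u].

Definition tail_layers k w P i : set (seq X) :=
  [set u | P (i + k)%N (take k w ++ u)].

(** A letter has the normal form [x^+ x], with A_0 = {1, x} and A_1 = {1}. *)
Definition letter_layers (x : X) i : set (seq X) :=
  [set u : seq X | i <= 1 /\ (u = [:: x] \/ i = 0%N /\ u = [::])].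

Lemma layering_mul w v P Q :
  layering w P -> layering v Q -> layering (w ++ v) (mul_layers w P Q).
Proof.
move=> lP lQ; split.
- move=> i u [/(layer_take lP)[iw ->]|[s /(layer_take lQ)[iv e] <-]].
    by rewrite size_cat takel_cat //; split=> //; lia.
  by rewrite size_cat !take_cat e; split=> //; lia.
- move=> i j u ij [Pu|[s Qs <-]]; [left|right].
    exact: (layer_anti lP ij Pu).
  by exists s => //; apply: (layer_anti lQ _ Qs); lia.
- move=> i; rewrite size_cat => ile; right; exists v => //.
  by apply: (layer_word lQ); lia.
- move=> i k u ik [Pu|[s Qs <-]]; first by left; exact: (layer_prefix lP).
  (* A prefix shorter than [w] is a prefix of [w] itself, which lies in [P i] by [layer_word]. *)
  rewrite take_cat; case: ltnP => kw.
    by left; apply: (layer_prefix lP) => //; apply: (layer_word lP); lia.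
  by right; exists (take (k - size w) s) => //; apply: (layer_prefix lQ) => //; lia.
- move=> i; rewrite finite_setU; split; first exact: (layer_finite lP).
  exact/finite_image/(layer_finite lQ).
Qed.

Lemma layering_one : layering [::] one_layers.
Proof.
split=> [i u [-> ->]|i j u ij [j0 ->]|i|i k u ik [-> ->]|i] //; rewrite /one_layers /=.
- by split=> //; lia.
- by rewrite leqn0 => /eqP.
- by apply: (sub_finite_set (B := [set [::]])) => [u [_ ->]|].
Qed.

Lemma layering_head k w P : layering w P -> layering (take k w) (head_layers k P).
Proof.
move=> lP; split.
- move=> i u [ik /(layer_take lP)[iw ->]]; rewrite size_take take_takel //.
  by split=> //; case: ifP => _.
- move=> i j u ij [jk Pu]; split; first exact: leq_trans jk.
  exact: (layer_anti lP ij Pu).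
- move=> i; rewrite size_take => ik.
  have ? : i <= k by move: ik; case: ifP; lia.
  split=> //; apply: (layer_prefix lP) => //; apply: (layer_word lP).
  by move: ik; case: ifP; lia.
- by move=> i m u im [ik Pu]; split=> //; apply: (layer_prefix lP).
- move=> i; apply: sub_finite_set (layer_finite lP i).
  by move=> u [].
Qed.

Lemma layering_tail k w P :
  k <= size w -> layering w P -> layering (drop k w) (tail_layers k w P).
Proof.
move=> kw lP; have tk : size (take k w) = k by rewrite size_takel.
split.
- move=> i u /(layer_take lP)[ik]; rewrite size_drop => e; split; first lia.
  move: e; rewrite -{2}(cat_take_drop k w) !take_cat tk ltnNge leq_addl /=.
  by rewrite addnK => /(congr1 (drop k)); rewrite !drop_size_cat.
- move=> i j u ij; apply: (layer_anti lP); lia.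
- move=> i; rewrite size_drop /tail_layers /= cat_take_drop => ik.
  by apply: (layer_word lP); lia.
- move=> i m u im Pu; have := layer_prefix lP (k := m + k) _ Pu.
  rewrite take_cat tk ltnNge leq_addl addnK; apply; lia.
- move=> i; apply: sub_finite_set (finite_image (drop k) (layer_finite lP (i + k))).
  by move=> u Pu; exists (take k w ++ u) => //; rewrite drop_size_cat.
Qed.

Lemma layering_letter x : layering [:: x] (letter_layers x).
Proof.
split.
- by move=> i u [i1 [->|[-> ->]]].
- move=> i j u ij [j1 [->|[j0 ->]]]; split; [lia|by left|lia|right].
  by split=> //; lia.
- by move=> i i1; split=> //; left.
- move=> i [|k] u ik [i1 uE]; split=> //.
    by right; split; [lia|case: u uE].
  by case: uE => [->|[-> ->]]; [left|right].
- move=> i; apply: (sub_finite_set (B := [set [:: x]; [::]])) => [u|].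
    by case=> _ [->|[_ ->]]; [left|right].
  exact: finite_set2.
Qed.

End Layers.

Record layered (X : Type) := Layered {
  word : seq X;
  layer : nat -> set (seq X);
  layeredP : layering word layer
}.

HB.instance Definition _ (X : Type) := gen_eqMixin (layered X).
HB.instance Definition _ (X : Type) := gen_choiceMixin (layered X).

(** * The left h-Ehresmann structure on the model *)

Section LayeredMonoid.
Variable X : Type.
Implicit Types a b c u v : layered X.

Lemma layered_ext a b :
  word a = word b -> (forall i z, layer a i z <-> layer b i z) -> a = b.
Proof.
case: a b => w P lP [v Q lQ] /= wv PQ; rewrite wv in lP *.
have {}PQ : P = Q by apply/funext => i; apply/seteqP; split=> z; apply PQ.
by rewrite PQ in lP *; rewrite (Prop_irrelevance lP lQ).
Qed.

Definition layered_mul a b :=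
  Layered (layering_mul (layeredP a) (layeredP b)).
Definition layered_one := Layered (layering_one X).
Definition layered_head k a := Layered (layering_head k (layeredP a)).
Definition layered_tail k a (ka : k <= size (word a)) :=
  Layered (layering_tail ka (layeredP a)).
Definition layered_letter (x : X) := Layered (layering_letter x).

Lemma layered_mulA : associative layered_mul.
Proof.
move=> a b c; apply: layered_ext => [|i z] /=; first exact: catA.
rewrite /mul_layers /= size_cat subnDA; split.
  case=> [?|[s [?|[t ct <-]] <-]]; first by left; left.
    by left; right; exists s.
  by right; exists t; rewrite // catA.
case=> [[?|[s ? <-]]|[t ct <-]]; first by left.
  by right; exists s => //; left.
by right; exists (word b ++ t); rewrite ?catA //; right; exists t.
Qed.

Lemma layered_mul1 : left_id layered_one layered_mul.
Proof.
move=> a; apply: layered_ext => // i z /=.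
rewrite /mul_layers /one_layers /= subn0; split=> [[[-> ->]|[s ? <-]]|az] //.
  have := layer_prefix (layeredP a) (leqnn 0) (layer_word (layeredP a) (leq0n _)).
  by rewrite take0.
by right; exists z.
Qed.

Lemma layered_mulr1 : right_id layered_one layered_mul.
Proof.
move=> a; apply: layered_ext => [|i z] /=; first exact: cats0.
rewrite /mul_layers /one_layers /=; split=> [[//|[s [i0 ->] <-]]|]; last by left.
by rewrite cats0; apply: (layer_word (layeredP a)); lia.
Qed.

HB.instance Definition _ :=
  @isMonoid.Build (layered X) _ _ layered_mulA layered_mul1 layered_mulr1.

Lemma layered_mulE a b i z :
  layer (a * b) i z <-> layer a i z \/
    exists2 s, layer b (i - size (word a))%N s & word a ++ s = z.
Proof. by []. Qed.

Lemma word_mul a b : word (a * b) = word a ++ word b.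
Proof. by []. Qed.

Lemma layered_mul_cat a b i s :
  layer (a * b) i (word a ++ s) <->
  layer a i (word a ++ s) \/ layer b (i - size (word a))%N s.
Proof.
rewrite layered_mulE; split=> [[|[t bt /(congr1 (drop (size (word a))))]]|[]].
- by left.
- by rewrite !drop_size_cat // => <-; right.
- by left.
- by right; exists s.
Qed.

(** Only e(A_0) is kept; by [layer_anti], layer 0 already contains all later layers. *)
Definition layered_plus a := layered_head 0 a.

Lemma word_plus a : word (layered_plus a) = [::].
Proof. by rewrite /= take0. Qed.

Lemma layered_plusE a i z :
  layer (layered_plus a) i z <-> i = 0%N /\ layer a 0 z.
Proof. by rewrite /= /head_layers /= leqn0; split=> [[/eqP-> ]|[->]]. Qed.

Lemma layered_plus_mulE a b i z :
  layer (layered_plus a * b) i z <-> (i = 0%N /\ layer a 0 z) \/ layer b i z.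
Proof.
rewrite layered_mulE layered_plusE word_plus subn0.
split=> [[|[s ? <-]]|[]]; [by left|by right|by left|by right; exists z].
Qed.

(** Since [0 - size (word a)] truncates to 0, layer 0 of a product sees its right factor only
    through layer 0. This is the reason for [(xy)^+ = (xy^+)^+]. *)
Lemma layered_plus_mul_layer0 a b z :
  layer (a * layered_plus b) 0 z <-> layer (a * b) 0 z.
Proof.
rewrite !layered_mulE; split=> [] [?|[s bs <-]]; try by left.
  by right; exists s => //; case/layered_plusE: bs.
by right; exists s => //; apply/layered_plusE.
Qed.

Lemma layered_plus_ext a b :
  (forall z, layer a 0 z <-> layer b 0 z) -> layered_plus a = layered_plus b.
Proof.
move=> ab; apply: layered_ext => [|i z]; first by rewrite !word_plus.
by rewrite !layered_plusE ab.
Qed.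

Lemma layered_plus_mull a : layered_plus a * a = a.
Proof.
apply: layered_ext => [|i z]; first by rewrite word_mul word_plus.
by rewrite layered_plus_mulE; split=> [[[->]|]|]; auto.
Qed.

Lemma layered_plus_mul_plus a b :
  layered_plus (layered_plus a * layered_plus b) = layered_plus a * layered_plus b.
Proof.
apply: layered_ext => [|i z]; first by rewrite word_mul !word_plus.
by rewrite layered_plusE !layered_plus_mulE !layered_plusE; intuition.
Qed.

Lemma layered_plus_comm a b :
  layered_plus a * layered_plus b = layered_plus b * layered_plus a.
Proof.
apply: layered_ext => [|i z]; first by rewrite !word_mul !word_plus.
by rewrite !layered_plus_mulE !layered_plusE; intuition.
Qed.

Lemma layered_plus_mulr a b : layered_plus (a * b) = layered_plus (a * layered_plus b).
Proof. by apply: layered_plus_ext => z; rewrite layered_plus_mul_layer0. Qed.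

HB.instance Definition _ :=
  @isLeftEhresmann.Build (layered X) layered_plus layered_plus_mull
    layered_plus_mul_plus layered_plus_comm layered_plus_mulr.

(** Both sides amount to layer 0 of [a] together with the words [word a ++ s], for [s] in layer 0 of
    [b] or of [c]: prefixing by a word commutes with unions. *)
Lemma layered_plus_h a b c :
  plus (a * plus c * b) = plus (a * b) * plus (a * c) :> layered X.
Proof.
change (layered_plus (a * layered_plus c * b) =
        layered_plus (a * b) * layered_plus (a * c)).
apply: layered_ext => [|i z]; first by rewrite word_mul !word_plus.
rewrite layered_plus_mulE !layered_plusE -mulgA !layered_mulE.
have E s : layer (layered_plus c * b) 0 s <-> layer c 0 s \/ layer b 0 s.
  by rewrite layered_plus_mulE; intuition.
split=> [[-> [?|[s /E[] ? <-]]]|[[-> [?|[s ? <-]]]|[-> [?|[s ? <-]]]]].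
- by left; split=> //; left.
- by right; split=> //; right; exists s.
- by left; split=> //; right; exists s.
- by split=> //; left.
- by split=> //; right; exists s => //; apply/E; right.
- by split=> //; left.
- by split=> //; right; exists s => //; apply/E; left.
Qed.

HB.instance Definition _ := @isLeftHEhresmann.Build (layered X) layered_plus_h.

End LayeredMonoid.

(** * Freeness of the model *)

Section LeftEhresmannTheory.
Variable M : leftHEhresmannMonoidType.
Implicit Types x y z : M.

Lemma plus1 : plus 1 = 1 :> M.
Proof. by have := plus_mull (1 : M); rewrite mulg1. Qed.

Lemma plus_idem x : plus x * plus x = plus x.
Proof. by rewrite -plus_mul_plus -plus_mulr plus_mull. Qed.

Lemma plus_plusM x y : plus (plus x * y) = plus x * plus y.
Proof. by rewrite plus_mulr plus_mul_plus. Qed.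

End LeftEhresmannTheory.

(** * Evaluation of the model in a left h-Ehresmann monoid *)

Section NormalForm.
Variables (X : choiceType) (M : leftHEhresmannMonoidType) (h : X -> M).
Implicit Types (w u : seq X) (s t : seq (seq X)) (P Q : nat -> set (seq X)).

Definition word_val w : M := \prod_(x <- w) h x.

Definition pluses s : M := \prod_(u <- s) plus (word_val u).

Lemma pluses_cons u s : pluses (u :: s) = plus (word_val u) * pluses s.
Proof. by rewrite /pluses big_cons. Qed.

Lemma pluses_cat s t : pluses (s ++ t) = pluses s * pluses t.
Proof. by rewrite /pluses big_cat. Qed.

Lemma plus_pluses s : plus (pluses s) = pluses s.
Proof.
elim: s => [|u s IH]; first by rewrite /pluses big_nil plus1.
by rewrite pluses_cons plus_plusM IH.
Qed.

Lemma pluses_absorb u s : u \in s -> plus (word_val u) * pluses s = pluses s.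
Proof.
elim: s => // v s IH; rewrite inE pluses_cons => /predU1P[->|us].
  by rewrite mulgA plus_idem.
by rewrite mulgA (plus_comm (word_val u)) -mulgA IH.
Qed.

Lemma pluses_sub s t : {subset s <= t} -> pluses s * pluses t = pluses t.
Proof.
elim: s => [|u s IH] st; first by rewrite /pluses big_nil mul1g.
rewrite pluses_cons -mulgA IH => [|v vs]; first by rewrite pluses_absorb ?st ?mem_head.
by apply: st; rewrite inE vs orbT.
Qed.

Lemma pluses_comm s t : pluses s * pluses t = pluses t * pluses s.
Proof. by rewrite -(plus_pluses s) -(plus_pluses t) plus_comm. Qed.

(** Commuting idempotents: each of the two products absorbs the other. Hence order and multiplicity
    do not matter, and a product over a finite set makes sense. *)
Lemma eq_pluses s t : s =i t -> pluses s = pluses t.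
Proof.
move=> st; have st1 : {subset s <= t} by move=> u; rewrite st.
have ts : {subset t <= s} by move=> u; rewrite st.
by rewrite -(pluses_sub ts) pluses_comm pluses_sub.
Qed.

(* The only use of the h-identity: y |-> (x y)^+ is multiplicative on
   idempotents. *)
Lemma plus_letter_pluses x s :
  plus (h x * pluses s) = pluses ([:: x] :: map (cons x) s).
Proof.
elim: s => [|u s IH].
  by rewrite pluses_cons /pluses !big_nil !mulg1 /word_val big_seq1.
rewrite [pluses (u :: s)]pluses_cons mulgA plus_h IH.
rewrite -plus_pluses plus_comm plus_pluses /= !pluses_cons !mulgA.
rewrite (plus_comm (word_val _)); congr (_ * _ * _).
by rewrite /word_val big_cons.
Qed.

(** The element e(A); [fset_set] enumerates [A] only when [A] is finite, whence the finiteness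
    conditions below. *)
Definition set_pluses (A : set (seq X)) : M := pluses (fset_set A).

Lemma set_pluses_absorb A s : finite_set A -> (forall u, u \in s -> A u) ->
  pluses s * set_pluses A = set_pluses A.
Proof.
move=> fA sA; apply: pluses_sub => u us.
by rewrite in_fset_set //; apply/mem_set/sA.
Qed.

Lemma set_plusesU A B : finite_set A -> finite_set B ->
  set_pluses (A `|` B) = set_pluses A * set_pluses B.
Proof.
move=> fA fB; rewrite /set_pluses -pluses_cat; apply: eq_pluses => u.
by rewrite fset_setU // mem_cat finmap.inE.
Qed.

Lemma set_pluses_nil A : A = [set [::]] -> set_pluses A = 1.
Proof.
move=> ->; rewrite /set_pluses fset_set1.
rewrite (eq_pluses (t := [:: [::]])) => [|u]; last by rewrite !finmap.inE.
by rewrite pluses_cons /pluses big_nil mulg1 /word_val big_nil plus1.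
Qed.

(** The tail layers of the cut at 1, in a form suited to recursion on the word. Iterated shifts turn
    the absolute layers into the relative sets A_i. *)
Definition shift_layers x P i : set (seq X) := [set u | P i.+1 (x :: u)].

Lemma layering_shift x w P :
  layering (x :: w) P -> layering w (shift_layers x P).
Proof.
move=> lP; have -> : shift_layers x P = tail_layers 1 (x :: w) P.
  by apply/funext => i; rewrite /tail_layers addn1 /= take0.
by have := @layering_tail _ 1 (x :: w) P isT lP; rewrite /= drop0.
Qed.

Fixpoint normal_val w P : M :=
  if w is x :: w' then
    set_pluses (P 0%N) * (h x * normal_val w' (shift_layers x P))
  else set_pluses (P 0%N).

Lemma eq_normal_val w P Q :
  (forall i, P i = Q i) -> normal_val w P = normal_val w Q.
Proof. by move=> PQ; congr normal_val; apply/funext. Qed.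

(** By induction, the value is e(A_0) times the pluses of [x] and of the words in x A_1. All of
    these words lie in A_0 and are absorbed. *)
Lemma plus_normal_val w P : layering w P -> plus (normal_val w P) = set_pluses (P 0%N).
Proof.
elim: w P => [|x w IH] P lP /=; first exact: plus_pluses.
have lS := layering_shift lP.
rewrite /set_pluses -plus_pluses plus_plusM plus_pluses plus_mulr IH //.
rewrite /set_pluses plus_letter_pluses pluses_comm set_pluses_absorb //.
  exact: (layer_finite lP).
move=> u; rewrite inE => /predU1P[->|/mapP[v]].
  have := layer_prefix lP (k := 1) (leq0n _) (layer_word lP (leq0n _)).
  by rewrite /= take0.
rewrite in_fset_set; last exact: (layer_finite lS).
by move=> /set_mem Pv ->; apply: (layer_anti lP (leq0n 1)).
Qed.

Lemma layer_nil P : layering [::] P -> forall i, (0 < i)%N -> P i = set0.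
Proof.
move=> lP i i0; apply/seteqP; split=> // u /(layer_take lP)[/=]; lia.
Qed.

Lemma normal_valM w v P Q : layering w P -> layering v Q ->
  normal_val (w ++ v) (mul_layers w P Q) = normal_val w P * normal_val v Q.
Proof.
elim: w P => [|x w IH] P lP lQ.
  have PQ0 : mul_layers [::] P Q 0%N = P 0%N `|` Q 0%N.
    by rewrite /mul_layers /= image_id.
  case: v lQ => [|y v] lQ /=; rewrite PQ0 set_plusesU;
    do ?[exact: (layer_finite lP)|exact: (layer_finite lQ)] => //.
  rewrite -mulgA; congr (_ * (_ * (_ * _))); apply: eq_normal_val => i.
  apply/seteqP; split=> u; rewrite /shift_layers /mul_layers /= (layer_nil lP) //.
    by case=> [[]|[s Qs <-]].
  by move=> Qu; right; exists (y :: u).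
have lS := layering_shift lP; rewrite [LHS]/=.
have -> : shift_layers x (mul_layers (x :: w) P Q) = mul_layers w (shift_layers x P) Q.
  apply/funext => i; apply/seteqP; rewrite /shift_layers /mul_layers /= subSS.
  split=> u [Pu|[s Qs]]; [by left|case=> <-; right; exists s => //|by left|].
  by move=> <-; right; exists s.
have lSQ := layering_mul lS lQ.
set n := normal_val (w ++ v) _.
have nE : n = normal_val w (shift_layers x P) * normal_val v Q by exact: IH.
rewrite -[RHS]mulgA -mulgA -nE.
(* Layer 0 of the product exceeds [P 0] by the words [x :: w ++ t] with [t] in [Q 0]. The pluses of
   these words occur in [(h x * n)^+], which is therefore inserted on both sides. *)
have hx : h x * n = plus (h x * n) * (h x * n) by rewrite plus_mull.
rewrite {}hx mulgA [in RHS]mulgA; congr (_ * _).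
rewrite plus_mulr plus_normal_val // plus_letter_pluses.
set s := _ :: _.
have fP := layer_finite lP 0; have fPQ := layer_finite (layering_mul lP lQ) 0.
rewrite /set_pluses -!pluses_cat; apply: eq_pluses => u.
rewrite !mem_cat !in_fset_set //.
apply/orP/orP => -[uP|us]; try by right.
  move/set_mem: uP => [Pu|[t Qt <-]]; first by left; apply/mem_set.
  right; rewrite inE; apply/orP; right; apply: map_f.
  rewrite in_fset_set; last exact: (layer_finite lSQ).
  by apply/mem_set; right; exists t.
by left; apply/mem_set; left; exact: set_mem.
Qed.

Definition layered_val (a : layered X) : M := normal_val (word a) (layer a).

Lemma layered_val_morphism : lhe_morphism layered_val.
Proof.
split=> [a b|a|].
- exact: normal_valM (layeredP a) (layeredP b).
- rewrite /layered_val plus_normal_val; last exact: layeredP.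
  rewrite [plus a]/(layered_plus a) word_plus /=; congr set_pluses.
  by apply/seteqP; split=> [u []|u].
- rewrite /layered_val /= set_pluses_nil //.
  by apply/seteqP; split=> [u []|u ->].
Qed.

Lemma layered_val_letter x : layered_val (layered_letter x) = h x.
Proof.
rewrite /layered_val /= (@set_pluses_nil (shift_layers _ _ _)); last first.
  by apply/seteqP; split=> [u [_ [[]|[]]]|u ->] //; split=> //; left.
rewrite mulg1 -[in RHS](plus_mull (h x)); congr (_ * _).
rewrite /set_pluses (eq_pluses (t := [:: [:: x]; [::]])).
  rewrite !pluses_cons /pluses big_nil /word_val big_seq1 big_nil plus1.
  by rewrite !mulg1.
move=> u; rewrite in_fset_set; last exact: (layer_finite (layering_letter x)).
rewrite !inE; apply/idP/orP => [/set_mem[_ [->|[_ ->]]]|uE]; first by left.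
  by right.
by apply/mem_set; split=> //; case: uE => /eqP; auto.
Qed.

End NormalForm.

(** * Elements of the model as their own normal forms *)

Section ModelNormalForm.
Variable X : choiceType.

Lemma letter_word_val u i z :
  layer (plus (word_val (@layered_letter X) u)) i z <->
  i = 0%N /\ exists k, z = take k u.
Proof.
rewrite [plus _]/(layered_plus _) layered_plusE.
suff -> : layer (word_val (@layered_letter X) u) 0 z <-> exists k, z = take k u by [].
rewrite /word_val; elim: u z => [|x u IH] z.
  by rewrite big_nil; split=> [[_ ->]|[k ->]]; [exists 0|].
rewrite big_cons layered_mulE; split.
  case=> [[_ [->|[_ ->]]]|[s /IH[k ->] <-]].
  - by exists 1%N; rewrite /= take0.
  - by exists 0%N.
  - by exists k.+1.
case=> -[|k] ->; first by left; split=> //; right.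
by right; exists (take k u) => //; apply/IH; exists k.
Qed.

Lemma word_pluses (s : seq (seq X)) : word (pluses (@layered_letter X) s) = [::].
Proof. by rewrite -plus_pluses; exact: word_plus. Qed.

Lemma layer_pluses (s : seq (seq X)) i z :
  layer (pluses (@layered_letter X) s) i z <->
  i = 0%N /\ (z = [::] \/ exists2 u, u \in s & exists k, z = take k u).
Proof.
elim: s => [|v s IH].
  rewrite /pluses big_nil; split=> [[-> ->]|[-> [->|[]]]] //.
  by split=> //; left.
rewrite pluses_cons [plus _]/(layered_plus _) layered_plus_mulE IH.
have <- := layered_plusE _ i z; have -> := letter_word_val v i z.
split.
- case=> [[-> [k ->]]|[-> [->|[u us uk]]]]; split=> //.
  + by right; exists v; [exact: mem_head|exists k].
  + by left.
  + by right; exists u => //; rewrite inE us orbT.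
- case=> -> [->|[u]]; first by right; split=> //; left.
  rewrite inE => /predU1P[-> ?|us uk]; first by left.
  by right; split=> //; right; exists u.
Qed.

Lemma layer_set_pluses w (P : nat -> set (seq X)) i z : layering w P ->
  layer (set_pluses (@layered_letter X) (P 0%N)) i z <-> i = 0%N /\ P 0%N z.
Proof.
move=> lP; rewrite layer_pluses; split=> -[-> H]; split=> //.
- case: H => [->|[u]].
    by have := layer_prefix lP (leqnn 0) (layer_word lP (leq0n _)); rewrite take0.
  rewrite in_fset_set; last exact: (layer_finite lP).
  by move=> /set_mem Pu [k ->]; apply: (layer_prefix lP).
- right; exists z; last by exists (size z); rewrite take_size.
  by rewrite in_fset_set; [exact/mem_set|exact: (layer_finite lP)].
Qed.

(** This shows that the letters generate the model, so that the map from the free monoid onto it is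
    invertible. *)
Lemma layered_val_id a : layered_val (@layered_letter X) a = a.
Proof.
case: a => w P lP; rewrite /layered_val /=.
suff [wE lE] : word (normal_val (@layered_letter X) w P) = w /\
    forall i z, layer (normal_val (@layered_letter X) w P) i z <-> P i z.
  exact: layered_ext.
elim: w P lP => [|x w IH] P lP.
  split=> [|i z]; first exact: word_pluses.
  rewrite /normal_val.
  rewrite (layer_set_pluses i z lP); split=> [[->]|Pz] //.
  by have [+ _] := layer_take lP Pz; rewrite leqn0 => /eqP i0; rewrite i0 in Pz *.
have [wE lE] := IH _ (layering_shift lP).
rewrite [normal_val _ _ _]/(set_pluses _ (P 0%N) *
  (layered_letter x * normal_val _ w (shift_layers x P))).
rewrite !word_mul word_pluses wE; split=> // i z.
rewrite layered_mulE (layer_set_pluses i z lP) word_pluses subn0.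
pose n := layered_letter x *
  normal_val (@layered_letter X) w (shift_layers x P).
have E : (exists2 s, layer n i s & [::] ++ s = z) <-> layer n i z.
  by split=> [[s ? <-]|] //; exists z.
rewrite {}E layered_mulE; split.
- case=> [[-> //]|[[i1 [->|[-> ->]]]|[s /lE Ps <-]]].
  + have := layer_prefix lP i1 (layer_word lP (leq_trans i1 _)).
    by rewrite /= take0; exact.
  + by have := layer_prefix lP (leqnn 0) (layer_word lP (leq0n _)); rewrite take0.
  + by apply: (layer_anti lP _ Ps) => /=; lia.
(* The leading idempotent supplies layer 0. A word in layer [i.+1] starts with [x], and its
   remainder lies in layer [i] of the shift. *)
- case: i => [|i] Pz; first by left.
  right; right; have [_] := layer_take lP Pz.
  case: z Pz => [|y z] Pz //= [yx _].
  rewrite yx in Pz *; exists z => //; apply/lE.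
  by rewrite /shift_layers /= subSS subn0.
Qed.

End ModelNormalForm.

(** The universal property gives [f], and normal forms give [g]. Uniqueness of the extension of
    [iota] makes [g] after [f] the identity; [f] carries normal forms in [F] to those in the model,
    so [layered_val_id] settles the other composite. *)
Lemma free_lhe_layered (X : choiceType) (F : leftHEhresmannMonoidType)
    (iota : X -> F) : is_free_lhe iota ->
  exists (f : F -> layered X) (g : layered X -> F),
    [/\ cancel f g, cancel g f & {morph f : x y / x * y}].
Proof.
move=> [_ univ]; have [f [[fM fP f1] fi _]] := univ _ (@layered_letter X).
have [gM gP g1] := layered_val_morphism iota.
exists f, (layered_val iota); split=> //.
  have [k [_ _ kU]] := univ _ iota.
  move=> y; rewrite [RHS](kU id) //; apply: (kU (layered_val iota \o f)).
    by split=> [a b|a|] /=; rewrite ?fM ?gM ?fP ?gP ?f1 ?g1.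
  by move=> x; rewrite /= fi layered_val_letter.
have fprod s : f (word_val iota s) = word_val (@layered_letter X) s.
  rewrite /word_val; elim: s => [|x s IH]; first by rewrite !big_nil f1.
  by rewrite !big_cons fM IH fi.
have fpl s : f (pluses iota s) = pluses (@layered_letter X) s.
  rewrite /pluses; elim: s => [|u s IH]; first by rewrite !big_nil f1.
  by rewrite !big_cons fM IH fP fprod.
move=> a; rewrite -[RHS]layered_val_id /layered_val.
elim: (word a) (layer a) => [|x w IH] P /=; first exact: fpl.
by rewrite !fM fpl IH fi.
Qed.

(** * Annihilators and least common multiples in the model *)

Section LayeredFinitary.
Variable X : Type.
Implicit Types a b c u v : layered X.

Lemma cat_inj_size (s1 s2 t1 t2 : seq X) :
  size s1 = size t1 -> s1 ++ s2 = t1 ++ t2 -> s1 = t1 /\ s2 = t2.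
Proof.
move=> st e; split.
  move: (congr1 (take (size s1)) e).
  by rewrite take_size_cat // take_size_cat.
move: (congr1 (drop (size s1)) e).
by rewrite drop_size_cat // drop_size_cat.
Qed.

Lemma cat_cancel (s t1 t2 : seq X) : s ++ t1 = s ++ t2 -> t1 = t2.
Proof. by case/cat_inj_size. Qed.

Lemma layer_le_size a i z : layer a i z -> i <= size (word a).
Proof. by case/(layer_take (layeredP a)). Qed.

(** The witness is the last idempotent e(A_n) of [a]. Reading [a * u] at layer [i + size (word a)]
    and words starting with [word a] gives exactly layer [i] of [e * u]. *)
Lemma layered_right_stabilized : right_stabilized (layered X).
Proof.
move=> a; pose e := layered_tail (leqnn (size (word a))); exists e.
have we : word e = [::] by rewrite /= drop_size.
have eE i s : layer e i s <-> layer a (i + size (word a)) (word a ++ s).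
  by rewrite /= /tail_layers /= take_size.
split=> [|u v auv].
  apply: layered_ext => [|i z]; first by rewrite word_mul we cats0.
  rewrite layered_mulE; split=> [[//|[s /eE es <-]]|]; last by left.
  by apply: (layer_anti (layeredP a) _ es); lia.
have wuv : word u = word v.
  by have /cat_inj_size[] := congr1 (@word X) auv.
apply: layered_ext => [|i s]; first by rewrite !word_mul we wuv.
have: layer (a * u) (i + size (word a)) (word a ++ s) <->
      layer (a * v) (i + size (word a)) (word a ++ s) by rewrite auv.
rewrite !layered_mul_cat addnK.
have eM c : layer (e * c) i s <-> layer e i s \/ layer c i s.
  by have := layered_mul_cat e c i s; rewrite we subn0.
by rewrite !eM eE.
Qed.

(* When a common multiple exists, the idempotents t with b t in aM form a family
   closed under arbitrary intersection of their sets of words; the intersection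
   L of all of them yields the least common multiple b t. *)
Lemma layered_right_lcm_le a b u v : size (word a) <= size (word b) ->
  a * u = b * v -> exists p q, a * p = b * q /\
    forall u' v', a * u' = b * v' -> exists m, b * v' = b * q * m.
Proof.
move=> ab auv.
pose L i : set (seq X) := [set s | i = 0%N /\
  forall u' v', a * u' = b * v' -> layer v' 0 s].
have lL : layering [::] L.
  split=> [i s [-> _]|i j s ij [j0 Ls]|i|i k s ik [i0 Ls]|i] //.
  - by rewrite !take0.
  - by split=> //; lia.
  - rewrite leqn0 => /eqP ->; split=> // u' v' _.
    have := layer_prefix (layeredP v') (leqnn 0) (layer_word (layeredP v') (leq0n _)).
    by rewrite take0.
  - split=> // u' v' /Ls; apply: (layer_prefix (layeredP v')); lia.
  (* The given solution [v] bounds the intersection by a finite set. *)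
  - by apply: sub_finite_set (layer_finite (layeredP v) 0) => s [_ h]; exact: h auv.
pose t := Layered lL.
have tabs u' v' : a * u' = b * v' -> b * v' = b * t * v'.
  move=> auv'; rewrite -mulgA; congr (_ * _).
  apply: layered_ext => [//|i s]; rewrite (layered_mul_cat t v' i s) subn0.
  by split=> [|[[-> /(_ _ _ auv')]|]] //; right.
have wbt : word (b * t) = word b by rewrite word_mul cats0.
have [z wb] : exists z, word b = word a ++ z.
  have e := congr1 (@word X) auv; rewrite !word_mul in e.
  exists (drop (size (word a)) (word b)).
  have := congr1 (take (size (word a))) e.
  rewrite take_size_cat // takel_cat // => {1}->.
  by rewrite cat_take_drop.
have kbt : size (word a) <= size (word (b * t)) by rewrite wbt.
(* Cutting [b * t] after [word a] gives the cofactor of [a]. *)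
pose p := layered_tail kbt.
have tkE : take (size (word a)) (word (b * t)) = word a.
  by rewrite wbt wb take_size_cat.
have pE i s : layer p i s <-> layer (b * t) (i + size (word a)) (word a ++ s).
  by rewrite -{2}tkE.
exists p, t; split; last by move=> u' v' /tabs bv; exists v'.
apply: layered_ext => [|i y].
  by rewrite word_mul -[in LHS]tkE /= cat_take_drop.
have anti j k y' : j <= k -> layer (b * t) k y' -> layer (b * t) j y'.
  exact: (layer_anti (layeredP (b * t))).
rewrite layered_mulE; split.
- case=> [ay|[s /pE bs <-]]; last by apply: anti bs; lia.
  apply/layered_mulE; have [|nby] := pselect (layer b i y); [by left|right].
  (* A word of [a] missing from [b] must come from [v'] in every solution, and from its layer 0
     because [i <= size (word a) <= size (word b)]. So it lies in the intersection [L]. *)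
  have vy u' v' : a * u' = b * v' ->
      exists2 s, layer v' (i - size (word b)) s & word b ++ s = y.
    move=> e; have : layer (a * u') i y by left.
    by rewrite e => /layered_mulE[].
  have i0 : (i - size (word b) = 0)%N by have := layer_le_size ay; lia.
  have [s _ ys] := vy _ _ auv; exists s => //; split=> // u' v' /vy[s'].
  by rewrite i0 => ? e; rewrite -(@cat_cancel (word b) s' s) // e ys.
- move=> bty.
  (* The tail [p] only records layers from [size (word a)] on, so a word that is not in [a] has to
     be lifted to such a layer. *)
  have key : layer a i y \/ layer (b * t) (maxn i (size (word a))) y.
    have [ai|ia] := leqP (size (word a)) i; first by right.
    have {}ia := ltnW ia.
    move: bty => /layered_mulE[by_|[s ts ys]]; last first.
      by right; apply/layered_mulE; right; exists s => //;
         case: ts => _ Ls; split=> //; lia.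
    have [|nay] := pselect (layer a i y); [by left|right].
    have [|nby] := pselect (layer b (size (word a)) y); [by left|].
    (* Such a word comes from layer 0 of every [u'], hence persists up to layer [size (word a)] of
       [b * v']. There [b] lacks it, so every [v'] supplies it. *)
    have vy u' v' : a * u' = b * v' ->
        exists2 s, layer v' 0 s & word b ++ s = y.
      move=> e; have : layer (b * v') i y by left.
      rewrite -e => /layered_mulE[//|[s us ys]].
      have : layer (a * u') (size (word a)) y.
        by right; exists s => //; rewrite subnn;
           have -> : 0%N = (i - size (word a))%N by lia.
      rewrite e => /layered_mulE[//|[s' vs' ys']]; exists s' => //.
      by move: vs'; have -> : (size (word a) - size (word b) = 0)%N by lia.
    apply/layered_mulE; right; have [s _ ys] := vy _ _ auv; exists s => //.
    split; first lia.
    by move=> u' v' /vy[s' ? e]; rewrite -(@cat_cancel (word b) s' s) // e ys.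
  case: key => [|bty']; [by left|right].
  have [s ys] : exists s, y = word a ++ s.
    have [_ e] := layer_take (layeredP (b * t)) bty'.
    exists (drop (size (word a)) y); rewrite -{1}(cat_take_drop (size (word a)) y).
    have := congr1 (take (size (word a))) e.
    by rewrite !take_takel ?leq_maxr // tkE => ->.
  exists s => //; apply/pE; rewrite -ys.
  by have -> : (i - size (word a) + size (word a) = maxn i (size (word a)))%N by lia.
Qed.

Lemma layered_right_lcm : right_lcm (layered X).
Proof.
move=> a b u v auv; have [ab|/ltnW ba] := leqP (size (word a)) (size (word b)).
  have [p [q [pq pqP]]] := layered_right_lcm_le ab auv.
  by exists p, q; split=> // u' v' e; rewrite pq e; apply: pqP e.
have [p [q [pq pqP]]] := layered_right_lcm_le ba (esym auv).
by exists q, p; split=> // u' v' e; apply: pqP (esym e).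
Qed.

(** Cancellation of words gives [word u = word v]. Up to layer [size (word u)], only layer 0 of [a]
    enters [u * a], as it does [u * a^+]; beyond that, [u * a^+] has empty layers. *)
Lemma layered_left_stabilized a :
  plus a * a = a /\ forall u v, u * a = v * a -> u * plus a = v * plus a.
Proof.
split=> [|u v uva]; first exact: plus_mull.
have wuv : word u = word v.
  have := congr1 (@word X) uva; rewrite !word_mul => e.
  have := congr1 size e; rewrite !size_cat => /addIn se.
  by have [] := cat_inj_size se e.
change (u * layered_plus a = v * layered_plus a).
apply: layered_ext => [|i z]; first by rewrite !word_mul wuv.
have := layered_mulE u a i z; rewrite uva (layered_mulE v a) -wuv => e.
rewrite !layered_mulE -wuv.
have pE s : layer (layered_plus a) (i - size (word u)) s <->
   (i <= size (word u))%N /\ layer a (i - size (word u)) s.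
  rewrite layered_plusE -subn_eq0.
  by split=> -[]; [move=> ->|move=> /eqP ->].
have [iu|ui] := leqP i (size (word u)).
  have E c :
      (layer c i z \/ exists2 s,
         layer (layered_plus a) (i - size (word u)) s & word u ++ s = z) <->
      (layer c i z \/ exists2 s,
         layer a (i - size (word u)) s & word u ++ s = z).
    by split=> -[|[s as_ sz]]; [left|right; exists s; case/pE: as_|left|
       right; exists s => //; apply/pE].
  by rewrite !E e.
by split=> -[/layer_le_size|[s /pE[]]]; rewrite -?wuv; lia.
Qed.

(* If a and b have words of the same length, the least common left multiple is
   b^+ a = a^+ b; if the word of b is longer, b is already a left multiple of a. *)
Lemma layered_left_lcm_le a b u v : size (word a) <= size (word b) ->
  u * a = v * b -> exists p q, p * a = q * b /\
    forall u' v', u' * a = v' * b -> exists m, v' * b = m * (q * b).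
Proof.
move=> ab uavb.
have wE u' v' : u' * a = v' * b -> word u' ++ word a = word v' ++ word b.
  by move=> /(congr1 (@word X)); rewrite !word_mul.
have layE u' v' i s : u' * a = v' * b ->
    layer u' i (word u' ++ s) \/ layer a (i - size (word u')) s <->
    layer v' i (word u' ++ s) \/ exists2 t, layer b (i - size (word v')) t &
      word v' ++ t = word u' ++ s.
  by move=> e; rewrite -layered_mul_cat e layered_mulE.
move: ab; rewrite leq_eqVlt => /predU1P[ab|ab].
  have sz u' v' : u' * a = v' * b -> word u' = word v' /\ word a = word b.
    move=> /wE e; apply: cat_inj_size => //.
    by have := congr1 size e; rewrite !size_cat ab => /addIn.
  have [wuv wab] := sz _ _ uavb.
  (* Beyond [size (word u)] neither [u] nor [v] has words, so the common multiple exposes the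
     positive layers of [a] and [b]. *)
  have lab j s : (0 < j)%N -> layer a j s <-> layer b j s.
    move=> j0; have := layered_mul_cat u a (j + size (word u)) s.
    have := layered_mul_cat v b (j + size (word v)) s.
    rewrite -wuv -uavb !addnK => -> e.
    have nu c : word c = word u ->
        ~ layer c (j + size (word u)) (word u ++ s).
      by move=> wc /layer_le_size; rewrite wc; lia.
    by have := nu u erefl; have := nu v (esym wuv); move: e; tauto.
  exists (plus b), (plus a); split.
    change (layered_plus b * a = layered_plus a * b).
    apply: layered_ext => [|i z]; first by rewrite !word_mul !word_plus.
    rewrite !layered_plus_mulE; case: i => [|i].
      by tauto.
    by rewrite lab //; split=> -[[]|] //; right.
  (* Inserting [a^+] changes nothing: the words it adds come from layer 0 of [a], hence already
     occur in [u' * a = v' * b]. *)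
  move=> u' v' e; exists v'; have [wuv' _] := sz _ _ e.
  change (v' * b = v' * (layered_plus a * b)).
  apply: layered_ext => [|i z]; first by rewrite !word_mul !word_plus.
  rewrite layered_mulE [X in _ <-> X]layered_mulE.
  split=> [[|[s bs sz']]|[|[s /layered_plus_mulE[[i0 as_]|bs] sz']]];
    try by left.
  - by right; exists s => //; apply/layered_plus_mulE; right.
  - have : layer (u' * a) i z by right; exists s; rewrite wuv' ?i0.
    by rewrite e layered_mulE.
  - by right; exists s.
pose k := (size (word b) - size (word a))%N.
have [wb wu] : word b = take k (word b) ++ word a /\ word u = word v ++ take k (word b).
  have e := wE _ _ uavb.
  have sz : size (word u) = size (word v ++ take k (word b)).
    have := congr1 size e; rewrite !size_cat size_takel /k; lia.
  rewrite -(cat_take_drop k (word b)) catA in e.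
  have [-> ->] := cat_inj_size sz e; split=> //.
  by rewrite cat_take_drop.
(* The claim is that [b] is its head of length [k] times [a]: above [k] its layers are those of [a],
   and layer 0 of [a] embeds in its layer [k]. *)
exists (layered_head k b), 1; split; last first.
  by move=> u' v' e; exists v'; rewrite mul1g.
rewrite mul1g; have tk : size (take k (word b)) = k by rewrite size_takel /k; lia.
have szu : size (word u) = (size (word v) + k)%N by rewrite wu size_cat tk.
have nlay (c : layered X) j z : (size (word c) < j)%N -> ~ layer c j z.
  by move=> ? /layer_le_size; lia.
have key i s : (k < i)%N -> layer a (i - k) s <-> layer b i (take k (word b) ++ s).
  move=> ki; have := layered_mul_cat u a (i + size (word v)) s.
  have := layered_mul_cat v b (i + size (word v)) (take k (word b) ++ s).
  rewrite catA -wu -uavb addnK szu addnC subnDl => -> e.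
  have := nlay u (size (word v) + i)%N (word u ++ s).
  have := nlay v (size (word v) + i)%N (word u ++ s).
  have h1 : (size (word v) < size (word v) + i)%N by lia.
  have h2 : (size (word u) < size (word v) + i)%N by lia.
  by move=> /(_ h1) ? /(_ h2) ?; move: e; tauto.
have key0 s : layer a 0 s -> layer b k (take k (word b) ++ s).
  move=> a0; have : layer (u * a) (size (word u)) (word u ++ s).
    by apply/layered_mul_cat; right; rewrite subnn.
  rewrite uavb {2}wu -catA layered_mul_cat szu addKn => -[|//].
  by move=> /layer_le_size; rewrite /k; lia.
apply: layered_ext => [|i z]; first by rewrite word_mul -wb.
rewrite layered_mulE /= tk /head_layers /=; split.
- case=> [[]//|[s as_ <-]]; have [ik|ki] := leqP i k.
    apply: (layer_anti (layeredP b) ik); apply: key0.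
    by move: as_; have -> : (i - k = 0)%N by lia.
  exact/key.
- move=> bz; have [ik|ki] := leqP i k; [by left|right].
  have [ib e] := layer_take (layeredP b) bz.
  have zE : z = take k (word b) ++ drop k z.
    rewrite -{1}(cat_take_drop k z); congr (_ ++ _).
    by rewrite -(take_takel z (ltnW ki)) e take_takel // ltnW.
  by exists (drop k z) => //; apply/key => //; rewrite -zE.
Qed.

Lemma layered_left_lcm a b u v : u * a = v * b -> exists p q, p * a = q * b /\
  forall u' v', u' * a = v' * b -> exists m, u' * a = m * (p * a).
Proof.
move=> uavb; have [ab|/ltnW ba] := leqP (size (word a)) (size (word b)).
  have [p [q [pq pqP]]] := layered_left_lcm_le ab uavb.
  by exists p, q; split=> // u' v' e; rewrite pq e; apply: pqP e.
have [p [q [pq pqP]]] := layered_left_lcm_le ba (esym uavb).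
by exists q, p; split=> // u' v' e; apply: pqP (esym e).
Qed.

End LayeredFinitary.

(** * Transfer along isomorphisms and conclusion *)

Section Transfer.
Variables (M N : monoidType) (f : M -> N) (g : N -> M).
Hypotheses (fK : cancel f g) (gK : cancel g f) (fM : {morph f : x y / x * y}).

Lemma right_stabilized_transfer : right_stabilized N -> right_stabilized M.
Proof.
move=> stabN a; have [e [ae eP]] := stabN (f a); exists (g e); split.
  by apply: (can_inj fK); rewrite fM gK.
move=> u v auv; apply: (can_inj fK); rewrite !fM gK; apply: eP.
by rewrite -!fM auv.
Qed.

Lemma right_lcm_transfer : right_lcm N -> right_lcm M.
Proof.
move=> lcmN a b u v auv.
have [p [q [pq pqP]]] : exists p q, f a * p = f b * q /\
    forall u' v', f a * u' = f b * v' -> exists m, f a * u' = f a * p * m.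
  by apply: (lcmN _ _ (f u) (f v)); rewrite -!fM auv.
exists (g p), (g q); split; first by apply: (can_inj fK); rewrite !fM !gK.
move=> u' v' e; have [|m um] := pqP (f u') (f v'); first by rewrite -!fM e.
by exists (g m); apply: (can_inj fK); rewrite !fM !gK.
Qed.

End Transfer.

Theorem corollary5p7 (X : Type) (F : leftHEhresmannMonoidType) (iota : X -> F) :
  is_free_lhe iota ->
  [/\ finitely_left_equated F,
      finitely_right_equated F,
      weakly_left_coherent F &
      weakly_right_coherent F].
Proof.
(* [{classic X}] supplies the choice structure that enumerating finite sets of words requires. *)
move=> /(@free_lhe_layered {classic X}) [f [g [fK gK fM]]].
have stabR : right_stabilized F.
  exact: right_stabilized_transfer fK gK fM (@layered_right_stabilized _).
have lcmR : right_lcm F.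
  exact: right_lcm_transfer fK gK fM (@layered_right_lcm _).
pose L : monoidType := layered {classic X}.
(* The same bijection is an isomorphism of opposites, so the left-hand facts about the model
   transfer in the same way. *)
have fMop : {morph (f : opposite F -> opposite L) : x y / x * y}.
  by move=> x y; exact: fM.
have stabL : right_stabilized (opposite F).
  apply: (@right_stabilized_transfer (opposite F) (opposite L) f g fK gK fMop) => a.
  by exists (plus (a : layered X)); exact: layered_left_stabilized.
have lcmL : right_lcm (opposite F).
  apply: (@right_lcm_transfer (opposite F) (opposite L) f g fK gK fMop) => a b u v.
  exact: (@layered_left_lcm _ a b u v).
split; [exact: right_stabilized_equated|exact: right_stabilized_equated|
        exact: right_stabilized_lcm_coherent|exact: right_stabilized_lcm_coherent].
Qed.
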